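(* Let $\kappa\in\mathbb{R}$ and let $L:(I,q)\to\mathbb{P}(\mathcal{L})$ be a closed polarised curve of finite type with space form arc-length polarisation with respect to $\kappa$. Then $L$ admits a resonance point on some multiple cover of $L$, where the resonance point $\mu$ satisfies $$\mu>-\frac{\kappa}{2}.$$
   Context: $\mathbb{R}^{3,1}$ is $\mathbb{R}^4$ with a symmetric bilinear form $(\cdot,\cdot)$ of signature $(-+++)$; $\mathcal{L}=\{X\in\mathbb{R}^{3,1}:(X,X)=0\}$ is the lightcone, and $\mathbb{P}(\mathcal{L})$ is its projectivisation (the lines $\langle X\rangle$ with $0\neq X\in\mathcal{L}$), the conformal $2$-sphere. For $x,y\in\mathbb{R}^{3,1}$, $x\wedge y\in\mathfrak{o}(3,1)$ is the map $(x\wedge y)v=(x,v)y-(y,v)x$. Polarised curve: $I$ is an open interval (for closed curves identified with the universal cover $\mathbb{R}$), $q$ is a non-vanishing quadratic differential on $I$, i.e. $q=\frac1m\,\mathrm{d}s^2$ in a coordinate $s$ with $m$ a non-vanishing real function, and $L:(I,q)\to\mathbb{P}(\mathcal{L})$ is a (smooth) regular curve, regarded as a line subbundle of $I\times\mathbb{R}^{3,1}$ with sections $\Gamma L$. $L$ is closed with period $T>0$ if $L$ and $q$ are $T$-periodic in $s$. Space form arc-length polarisation with respect to $\kappa$: there are a constant vector $\mathfrak{q}\in\mathbb{R}^{3,1}$ with $(\mathfrak{q},\mathfrak{q})=-\kappa$ and a section $X\in\Gamma L$ with $(X,\mathfrak{q})=-1$ such that $q=(\mathrm{d}X,\mathrm{d}X)$.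 (The set $\{X\in\mathcal{L}:(X,\mathfrak{q})=-1\}$ is a $2$-dimensional Riemannian space form of constant sectional curvature $\kappa$.) Let $\eta=q\,\frac{X\wedge \mathrm{d}X}{(\mathrm{d}X,\mathrm{d}X)}$ for any nowhere vanishing $X\in\Gamma L$ (independent of the choice of $X$). For $\mu\in\mathbb{R}$ let $A^\mu:I\to\mathrm{SO}(3,1)$ solve $\frac{\mathrm{d}}{\mathrm{d}s}A^\mu=-\mu\,\eta(\partial_s)A^\mu$, $A^\mu(0)=\mathrm{id}$; the monodromy matrix is $\mathcal{M}^\mu:=A^\mu(T)$. Finite type: the set $\{\mu\in\mathbb{R}:\mathcal{M}^\mu\text{ is non-diagonalisable}\}$ is finite (''diagonalisable'' means over $\mathbb{C}$). Resonance point: a spectral parameter $\mu\in\mathbb{R}\setminus\{0\}$ such that $\mathcal{M}^\mu$ is diagonalisable with single eigenvalue $1$ of multiplicity $4$ (i.e. $\mathcal{M}^\mu=\mathrm{id}$). A resonance point on a multiple cover of $L$ is a $\mu\in\mathbb{R}\setminus\{0\}$ for which there is an integer $\ell\ge1$ with $(\mathcal{M}^\mu)^\ell=\mathrm{id}$. *)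

(* Defs.v *)
From mathcomp Require Import all_boot all_order all_algebra.
From mathcomp Require Import complex.
From mathcomp Require Import all_classical all_reals all_analysis.

Set Implicit Arguments.
Unset Strict Implicit.
Unset Printing Implicit Defensive.

Import Order.TTheory GRing.Theory Num.Theory.
Import numFieldNormedType.Exports.

Local Open Scope classical_set_scope.
Local Open Scope ring_scope.

Section Minkowski.
Variable R : realType.

Definition gram : 'M[R]_4 := diag_mx (\row_i (if i == ord0 then -1 else 1)).

Definition lform (x y : 'cV[R]_4) : R := (x^T *m gram *m y) ord0 ord0.

Definition wedge (x y : 'cV[R]_4) : 'M[R]_4 :=
  y *m (x^T *m gram) - x *m (y^T *m gram).

Lemma wedge_mulE (x y v : 'cV[R]_4) :
  wedge x y *m v = lform x v *: y - lform y v *: x.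
Proof.
rewrite /wedge mulmxBl -!mulmxA !(mulmxA _ gram v) -!mul_mx_scalar.
by congr (y *m _ - x *m _); rewrite [LHS]mx11_scalar.
Qed.

Definition SO31 (B : 'M[R]_4) : Prop :=
  B^T *m gram *m B = gram /\ \det B = 1.

(* Membership in the projectivised lightcone. *)
Definition null_line (U : {vspace 'cV[R]_4}) : Prop :=
  \dim U = 1%N /\ forall x, x \in U -> lform x x = 0.

End Minkowski.

Section Smooth.
Variables (R : realType) (V : normedModType R).

Definition smooth (f : R -> V) : Prop :=
  forall n (s : R), derivable (derive1n n f) s 1.

End Smooth.

Section Curves.
Variable R : realType.
Implicit Types (L : R -> {vspace 'cV[R]_4}) (m : R -> R) (X : R -> 'cV[R]_4).

(* The curve is smooth and immersed: near every parameter it has a smooth lift,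
   and the tangent vector of the projected curve at s0, the class of X'(s0)
   modulo the line L s0, does not vanish. *)
Definition regular_curve L : Prop :=
  (forall s, null_line (L s)) /\
  (forall s0 : R, exists X : R -> 'cV[R]_4,
     [/\ smooth X,
         \forall s \near s0, L s = <[X s]>%VS
       & derive1 X s0 \notin L s0]).

(* The quadratic differential is q = ds^2 / m(s). *)
Definition polarisation m : Prop :=
  smooth (m : R -> R^o) /\ forall s, m s != 0.

Definition polarised_curve L m : Prop := regular_curve L /\ polarisation m.

Definition closed_curve L m (T : R) : Prop :=
  0 < T /\ forall s, L (s + T) = L s /\ m (s + T) = m s.

Definition line_section L X : Prop := smooth X /\ forall s, X s \in L s.

Definition nonvanishing_section L X : Prop :=
  line_section L X /\ forall s, X s != 0.

Definition arclength_polarisation (kappa : R) L m : Prop :=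
  exists (fq : 'cV[R]_4) (X : R -> 'cV[R]_4),
    [/\ lform fq fq = - kappa,
        line_section L X,
        forall s, lform (X s) fq = -1
      & forall s, (m s)^-1 = lform (derive1 X s) (derive1 X s)].

(* eta(d/ds). Replacing X by a nowhere vanishing multiple does not change it
   when X takes values in the lightcone. *)
Definition connection_form m X (s : R) : 'M[R]_4 :=
  ((m s)^-1 / lform (derive1 X s) (derive1 X s)) *: wedge (X s) (derive1 X s).

Definition parallel_frame (eta : R -> 'M[R]_4) (mu : R) (A : R -> 'M[R]_4) :
    Prop :=
  [/\ forall s, SO31 (A s),
      A 0 = 1%:M
    & forall s : R, is_derive s (1 : R) A (- mu *: (eta s *m A s))].

Definition diagonalizable_over_C (B : 'M[R]_4) : Prop :=
  diagonalizable (map_mx (real_complex R) B).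

Definition finite_type (M : R -> 'M[R]_4) : Prop :=
  finite_set [set mu : R | ~ diagonalizable_over_C (M mu)].

Definition resonance_on_multiple_cover (M : R -> 'M[R]_4) (mu : R) : Prop :=
  mu != 0 /\ exists l : nat, (0 < l)%N /\ M mu ^+ l = 1%:M.

End Curves.

(* Main.v *)
(**
  Let [x] be the section with [(x, fq) = -1] and [(x', x') = 1 / m]; then the
  connection form is [x /\ x'] and, for every [mu], the section
  [p = fq + mu x] is parallel.  It is [T]-periodic and
  [(p, p) = - kappa - 2 mu], so for [mu > - kappa / 2] the monodromy fixes a
  timelike vector: it is a rotation, of angle [theta] with
  [tr = 2 + 2 cos theta].

  If the trace is not constant on [mu > - kappa / 2], then by continuity it
  takes a value for which [theta / (2 pi)] is rational, and some power of the
  monodromy is the identity.  If it is constant there, then, the trace being an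
  entire function of [mu] equal to [4] at [mu = 0], the constant is [4] and the
  monodromy itself is the identity.  Instead of analyticity we use that the
  [k]-th divided differences of [mu |-> A mu T] are [O(C^k / sqrt k!)], which
  makes the Newton interpolation error vanish.
*)

Require Import Defs.
From mathcomp Require Import all_boot all_order all_algebra.
From mathcomp Require Import complex.
From mathcomp Require Import all_classical all_reals all_analysis.
From mathcomp Require Import ring lra.
Set Implicit Arguments.
Unset Strict Implicit.
Unset Printing Implicit Defensive.

Import Order.TTheory GRing.Theory Num.Theory.
Import numFieldNormedType.Exports.
Local Open Scope classical_set_scope.
Local Open Scope ring_scope.

(** * The Lorentz form and stabilisers of timelike vectors *)

Section LorentzAlgebra.
Context {R : realType}.
Implicit Types (u v w e p : 'cV[R]_4) (M : 'M[R]_4).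

Lemma lformE u v :
  lform u v = - (u 0 0 * v 0 0) + u 1 0 * v 1 0 + u 2%:R 0 * v 2%:R 0
              + u 3%:R 0 * v 3%:R 0.
Proof.
rewrite /lform -mulmxA mul_diag_mx mxE !big_ord_recl big_ord0 !mxE /=.
rewrite mulN1r !mul1r addr0 mulrN !addrA.
by congr (_ + _ * _ + _ * _ + _ * _); congr (_ _ _); apply/val_inj.
Qed.

Lemma lformC u v : lform u v = lform v u.
Proof. rewrite !lformE; ring. Qed.

Lemma lformDl u v w : lform (u + v) w = lform u w + lform v w.
Proof. rewrite !lformE !mxE; ring. Qed.

Lemma lformDr u v w : lform u (v + w) = lform u v + lform u w.
Proof. by rewrite ![lform u _]lformC lformDl. Qed.

Lemma lformZl a u v : lform (a *: u) v = a * lform u v.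
Proof. rewrite !lformE !mxE; ring. Qed.

Lemma lformZr a u v : lform u (a *: v) = a * lform u v.
Proof. by rewrite !(lformC u) lformZl. Qed.

Lemma lformBl u v w : lform (u - v) w = lform u w - lform v w.
Proof. by rewrite -scaleN1r lformDl lformZl mulN1r. Qed.

Lemma lformBr u v w : lform u (v - w) = lform u v - lform u w.
Proof. by rewrite ![lform u _]lformC lformBl. Qed.

Lemma lform0r u : lform u 0 = 0.
Proof. by rewrite -(scale0r u) lformZr mul0r. Qed.

Lemma lform_sum u v :
  lform u v = \sum_i (if i == ord0 then -1 else 1) * (u i 0 * v i 0).
Proof.
rewrite /lform -mulmxA mul_diag_mx mxE; apply: eq_bigr => i _.
by rewrite !mxE mulrCA.
Qed.

Lemma lform_nondegenerate v : (forall u, lform u v = 0) -> v = 0.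
Proof.
move=> v0; apply/matrixP => i j; rewrite ord1 [RHS]mxE.
have := v0 (delta_mx i 0); rewrite lform_sum (bigD1 i)//= big1 ?addr0.
  rewrite mxE !eqxx mul1r; case: ifP => _; last by rewrite mul1r.
  by move/eqP; rewrite mulN1r oppr_eq0 => /eqP.
by move=> k /negbTE ki; rewrite mxE ki mul0r mulr0.
Qed.

Lemma wedgeE u v i j :
  wedge u v i j = (if j == ord0 then -1 else 1) * (v i 0 * u j 0 - u i 0 * v j 0).
Proof.
rewrite /wedge /gram !mul_mx_diag !mxE !big_ord1 !mxE; ring.
Qed.

(** For a lift [X = a x] with [X' = a' x + a x'], this is the factor that [(X', X')] will cancel in
    the connection form. *)
Lemma wedge_lift u v (a b : R) :
  wedge (a *: u) (b *: u + a *: v) = a ^+ 2 *: wedge u v.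
Proof. by apply/matrixP => i j; rewrite [RHS]mxE !wedgeE !mxE; ring. Qed.

Lemma lform_isometry M u v :
  M^T *m gram R *m M = gram R -> lform (M *m u) (M *m v) = lform u v.
Proof.
by move=> MG; rewrite /lform trmx_mul -!mulmxA !(mulmxA M^T) !(mulmxA _ M) MG.
Qed.

(** The orthogonal complement of a timelike vector is spacelike, a reversed Cauchy-Schwarz
    inequality. *)
Lemma timelike_orthogonal_eq0 p e :
  lform p p < 0 -> lform e p = 0 -> lform e e <= 0 -> e = 0.
Proof.
rewrite !lformE => pp ep ee.
set e0 := e 0 0 in ep ee *; set e1 := e 1 0 in ep ee *.
set e2 := e 2%:R 0 in ep ee *; set e3 := e 3%:R 0 in ep ee *.
set p0 := p 0 0 in pp ep *; set p1 := p 1 0 in pp ep *.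
set p2 := p 2%:R 0 in pp ep *; set p3 := p 3%:R 0 in pp ep *.
have E0 : e0 ^+ 2 * (p0 ^+ 2 - (p1 ^+ 2 + p2 ^+ 2 + p3 ^+ 2)) <= 0.
  (* Lagrange's identity for the spatial parts, once [e0 * p0] is replaced by their dot product. *)
  have -> : e0 ^+ 2 * (p0 ^+ 2 - (p1 ^+ 2 + p2 ^+ 2 + p3 ^+ 2)) =
     (e1 ^+ 2 + e2 ^+ 2 + e3 ^+ 2 - e0 ^+ 2) * (p1 ^+ 2 + p2 ^+ 2 + p3 ^+ 2)
    - ((e1 * p2 - e2 * p1) ^+ 2 + (e1 * p3 - e3 * p1) ^+ 2
       + (e2 * p3 - e3 * p2) ^+ 2).
    have ep' : e0 * p0 = e1 * p1 + e2 * p2 + e3 * p3 by lra.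
    by rewrite mulrBr -exprMn ep'; ring.
  rewrite subr_le0 (@le_trans _ _ 0) ?addr_ge0 ?sqr_ge0//.
  by rewrite mulr_le0_ge0 ?addr_ge0 ?sqr_ge0//; rewrite !expr2; lra.
have e00 : e0 ^+ 2 = 0.
  apply/eqP; rewrite eq_le sqr_ge0 andbT.
  by rewrite -(@pmulr_lle0 _ (p0 ^+ 2 - (p1 ^+ 2 + p2 ^+ 2 + p3 ^+ 2)))//;
     rewrite !expr2; lra.
have [h1 h2 h3] : [/\ 0 <= e1 ^+ 2, 0 <= e2 ^+ 2 & 0 <= e3 ^+ 2].
  by rewrite !sqr_ge0.
have {}ee : e1 ^+ 2 + e2 ^+ 2 + e3 ^+ 2 <= 0 by move: e00; rewrite !expr2; lra.
have [k1 k2 k3] : [/\ e1 ^+ 2 = 0, e2 ^+ 2 = 0 & e3 ^+ 2 = 0] by split; lra.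
apply/matrixP => i j; rewrite ord1 [RHS]mxE.
suff: e i 0 ^+ 2 = 0 by move/eqP; rewrite sqrf_eq0 => /eqP.
case: i => [[|[|[|[|//]]]] lt].
- by rewrite (_ : Ordinal lt = 0)//; apply/val_inj.
- by rewrite (_ : Ordinal lt = 1)//; apply/val_inj.
- by rewrite (_ : Ordinal lt = 2%:R)//; apply/val_inj.
- by rewrite (_ : Ordinal lt = 3%:R)//; apply/val_inj.
Qed.

Lemma char_poly_horner M a : (char_poly M).[a] = \det (a%:M - M).
Proof.
rewrite /char_poly -horner_evalE -det_map_mx; congr (\det _).
apply/matrixP => i j; rewrite !mxE /= !horner_evalE hornerD hornerN hornerC.
by case: (i == j); rewrite ?mulr1n ?mulr0n ?hornerX ?horner0.
Qed.


Lemma det0_col_ker M : \det M = 0 -> exists2 v : 'cV[R]_4, v != 0 & M *m v = 0.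
Proof.
rewrite -det_tr => /eqP/det0P[v v0 vM].
exists v^T; first by rewrite -trmx0 (inj_eq trmx_inj).
by apply: trmx_inj; rewrite trmx_mul trmxK vM trmx0.
Qed.

Lemma det_gram : \det (gram R) = -1.
Proof.
rewrite /gram det_diag !big_ord_recl big_ord0 !mxE /=.
by rewrite !mulr1.
Qed.

(* [chi 1 = 0] comes from the fixed vector; isometry makes [chi] palindromic,
   and comparing [chi 2] with [chi (1/2)] suffices to see it. *)
Lemma char_poly_SO31_fixed M p : SO31 M -> p != 0 -> M *m p = p ->
  char_poly M = ('X - 1) ^+ 2 * ('X^2 - (\tr M - 2)%:P * 'X + 1).
Proof.
move=> [MG M1] p0 Mp.
have chi1 : (char_poly M).[1] = 0.
  rewrite char_poly_horner; apply/eqP; rewrite -det_tr; apply/det0P.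
  exists p^T; first by rewrite -trmx0 (inj_eq trmx_inj).
  by rewrite -trmx_mul mulmxBl mul_scalar_mx scale1r Mp subrr trmx0.
have chi2 : (char_poly M).[2] = 16 * (char_poly M).[2^-1].
  rewrite !char_poly_horner -det_tr.
  (* Since [M^T G M = G], transposing turns [2 - M] into a multiple of [1/2 - M]; the factor 16 is
     [(-2)^4]. *)
  have E : (2%:M - M)^T *m gram R *m M = (-2) *: (gram R *m ((2^-1)%:M - M)).
    rewrite linearB /= tr_scalar_mx 2!mulmxBl MG mul_scalar_mx -scalemxAl.
    rewrite mulmxBr mul_mx_scalar scalerBr scalerA scaleNr opprK mulNr.
    by rewrite divff ?pnatr_eq0// scaleN1r addrC.
  have /(congr1 (fun B => \det B)) := E.
  by rewrite detZ !det_mulmx det_gram M1; lra.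
have sz := size_char_poly M.
have c4 : (char_poly M)`_4 = 1.
  by have := char_poly_monic M; rewrite monicE lead_coefE sz => /eqP.
have c3 := char_poly_trace M (isT : (0 < 4)%N); rewrite /= in c3.
have c0 := char_poly_det M; rewrite M1 mulr1 -signr_odd expr0 in c0.
move: chi1 chi2; rewrite !horner_coef sz !big_ord_recl !big_ord0 /= c0 c3 c4.
rewrite !expr1n.
set c1 := _`_1; set c2 := _`_2 => chi1 chi2.
have c13 : c1 = - \tr M.
  have {}chi2 : 1 + c1 * 2 + c2 * 4 - \tr M * 8 + 16
            = 16 + 8 * c1 + 4 * c2 - 2 * \tr M + 1.
    move: chi2; rewrite /bump !leq0n !add1n !exprVn => chi2.
    by rewrite -[LHS]addr0 -[RHS]addr0; lra.
  lra.
have c2E : c2 = 2 * \tr M - 2 by lra.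
rewrite -[LHS]coefK sz poly_def !big_ord_recl big_ord0 /= c0 c3 c4.
rewrite -/c1 -/c2 c13 c2E.
rewrite /bump !leq0n !add1n -!mul_polyC !(rmorphB, rmorphM, rmorphN) /=.
by rewrite !rmorph_nat; ring.
Qed.


Lemma timelike_neq0 p : lform p p < 0 -> p != 0.
Proof.
by apply: contraTneq => ->; rewrite lformE !mxE !(mulr0, oppr0, addr0) ltxx.
Qed.

Lemma eq_colmul M N : (forall z : 'cV[R]_4, M *m z = N *m z) -> M = N.
Proof.
move=> MN; apply/matrixP => i j.
by have /colP/(_ i) := MN (delta_mx j 0); rewrite -!colE !mxE.
Qed.

(** * Isometries fixing a timelike vector *)

Section TimelikeStabiliser.
Variables (M : 'M[R]_4) (p : 'cV[R]_4).
Hypotheses (MSO : SO31 M) (pp : lform p p < 0) (Mp : M *m p = p).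

Let isoM u v : lform (M *m u) (M *m v) = lform u v.
Proof. by apply: lform_isometry; case: MSO. Qed.

(** Here [(e, p) = (M u, M p) - (u, p) = 0] and [(e, e) = (M u, M e) - (u, e) = 0], so [e] is null
    and orthogonal to a timelike vector. Thus the kernel and the range of [M - 1] meet only in 0,
    which does the work of semisimplicity at the eigenvalue 1. *)
Lemma fixed_range_eq0 u e : e = M *m u - u -> M *m e = e -> e = 0.
Proof.
move=> eE Me; apply: (timelike_orthogonal_eq0 pp).
  by rewrite -[in LHS]Mp eE lformBl Mp -{1}Mp isoM subrr.
by rewrite {1}eE lformBl -{1}Me isoM subrr.
Qed.

(** On the range of [M - 1] the quadratic factor alone annihilates: with [q] that factor,
    [q w = (M - 1) (q z)] lies in the range of [M - 1], and Cayley-Hamilton puts it in the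
    kernel. *)
Lemma Cayley_Hamilton_reduced (z : 'cV[R]_4) (w := M *m z - z) :
  M *m (M *m w) = (\tr M - 2) *: (M *m w) - w.
Proof.
have p0 := timelike_neq0 pp.
have := Cayley_Hamilton M; rewrite (char_poly_SO31_fixed MSO p0 Mp).
move: (\tr M - 2) => t.
have -> : ('X - 1) ^+ 2 * ('X^2 - t%:P * 'X + 1) =
          ('X - 1) * (('X^2 - t%:P * 'X + 1) * ('X - 1)) :> {poly R} by ring.
rewrite !(rmorphM, rmorphB, rmorphD, rmorphXn, rmorph1) /=.
rewrite horner_mx_X horner_mx_C -!mulmxE => CH.
pose q (y : 'cV[R]_4) := M *m (M *m y) - t *: (M *m y) + y.
have e0 : q w = 0.
  apply: (@fixed_range_eq0 (q z)).
    rewrite /q /w !(mulmxDr, mulmxBr, scalerBr, mulmxN) -!scalemxAr.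
    by apply/matrixP => i j; rewrite !mxE; ring.
  apply/eqP; rewrite -subr_eq0 -[X in _ - X]mul1mx -mulmxBl.
  have -> : q w = (M *m M - t%:M *m M + 1) *m ((M - 1) *m z).
    rewrite (mulmxBl M 1 z) mul1mx -/w mulmxDl mulmxBl mul1mx -!mulmxA.
    by rewrite mul_scalar_mx.
  by rewrite !mulmxA -[X in X *m z]mulmxA CH mul0mx.
have -> : M *m (M *m w) = q w + (t *: (M *m w) - w).
  by rewrite /q addrACA subrr addr0 addrNK.
by rewrite e0 add0r.
Qed.

(** Otherwise the quadratic factor has a real root [r] with [r ^+ 2 != 1]. Invariance of the form
    makes its eigenvector null and orthogonal to [p], which is impossible. *)
Lemma trace_timelike_stabiliser : -2 <= \tr M - 2 <= 2.
Proof.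
rewrite -ler_norml leNgt; apply/negP; set t := \tr M - 2 => t2.
have t4 : 0 <= t ^+ 2 - 4.
  rewrite subr_ge0 -real_normK ?num_real// (_ : 4 = 2 ^+ 2); last by ring.
  by rewrite ler_sqr ?nnegrE// ltW.
pose r := (t + Num.sqrt (t ^+ 2 - 4)) / 2.
have rE : r ^+ 2 - t * r + 1 = 0.
  have sE := sqr_sqrtr t4; rewrite /r; move: sE; set s := Num.sqrt _ => sE.
  have -> : ((t + s) / 2) ^+ 2 - t * ((t + s) / 2) + 1 =
            (s ^+ 2 - (t ^+ 2 - 4)) / 4 by field.
  by rewrite sE subrr mul0r.
have p0 := timelike_neq0 pp.
have : \det (r%:M - M) = 0.
  rewrite -char_poly_horner (char_poly_SO31_fixed MSO p0 Mp) -/t.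
  rewrite hornerM [X in _ * X](_ : _ = 0) ?mulr0// -rE.
  by rewrite !hornerE.
move=> /det0_col_ker[v v0]; rewrite mulmxBl mul_scalar_mx => /subr0_eq/esym Mv.
(* If [r ^+ 2 = 1], the quadratic gives [t r = 2], hence [t = 2] or [t = -2], both excluded. *)
have r1 : r ^+ 2 != 1.
  apply/eqP => r21; move: rE; rewrite r21 => tr2.
  have /eqP : (t - 2) * (t + 2) = 0.
    have : (t * r) ^+ 2 = 4 by rewrite (_ : t * r = 2) ?expr2; lra.
    by rewrite exprMn r21 expr2; lra.
  rewrite mulf_eq0 subr_eq0 addr_eq0 => /orP[]/eqP tE; move: t2;
  by rewrite tE ?normrN ger0_norm// ltxx.
have vp : lform v p = 0.
  have : r * lform v p = lform v p by rewrite -lformZl -Mv -{1}Mp isoM.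
  move=> h; apply/eqP; apply: contraNT r1 => vp.
  have r1 : r = 1 by apply: (mulIf vp); rewrite mul1r.
  by rewrite r1 expr1n.
have vv : lform v v = 0.
  have h : r ^+ 2 * lform v v = lform v v.
    by rewrite -{2}isoM Mv lformZl lformZr mulrA expr2.
  apply/eqP; apply: contraNT r1 => vv.
  by apply/eqP; apply: (mulIf vv); rewrite mul1r.
by move: v0; rewrite (timelike_orthogonal_eq0 pp vp) ?vv ?eqxx.
Qed.

(** With trace 4 the quadratic factor is also [(X - 1)^2]; two uses of [fixed_range_eq0] remove the
    two powers of [M - 1] acting on [w]. *)
Lemma trace4_eq1 : \tr M = 4 -> M = 1%:M.
Proof.
move=> tr4.
suff Mz (z : 'cV_4) : M *m z - z = 0.
  by apply: eq_colmul => z; rewrite mul1mx; apply/subr0_eq.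
have CH := Cayley_Hamilton_reduced z; set w := M *m z - z in CH *.
apply: (fixed_range_eq0 (u := z)) => //; apply/eqP; rewrite -subr_eq0; apply/eqP.
apply: (fixed_range_eq0 (u := w)) => //.
rewrite mulmxBr CH tr4 (_ : 4 - 2 = 2 :> R); last by ring.
by apply/matrixP => i j; rewrite !mxE; ring.
Qed.

Lemma rational_rotation_expr (theta : R) (l : nat) :
  sin theta != 0 -> \tr M - 2 = 2 * cos theta ->
  cos (l%:R * theta) = 1 -> M ^+ l = 1%:M.
Proof.
move=> s0 tE cl.
have sl : sin (l%:R * theta) = 0.
  by apply/eqP; rewrite -norm_cos_eq1 cl normr1.
(* The recurrence of [Cayley_Hamilton_reduced] with [t = 2 cos theta] is that of the Chebyshev
   polynomials of the second kind, multiplied through by [sin theta]. *)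
have pw (k : nat) (z : 'cV[R]_4) (w := M *m z - z) : sin theta *: (M ^+ k *m w) =
    sin (k%:R * theta) *: (M *m w) - sin (k%:R * theta - theta) *: w.
  elim: k => [|k IH].
    by rewrite expr0 mul1mx mul0r sin0 scale0r !sub0r sinN scaleNr opprK.
  rewrite exprS -mulmxA scalemxAr IH mulmxBr -!scalemxAr.
  rewrite Cayley_Hamilton_reduced tE -/w.
  set x := k%:R * theta.
  have -> : k.+1%:R * theta = x + theta by rewrite -natr1 mulrDl mul1r.
  rewrite addrK scalerBr scalerA addrAC -scalerBl; congr (_ *: _ - _).
  by rewrite sinB sinD; ring.
have fixw (z : 'cV[R]_4) : M ^+ l *m (M *m z - z) = M *m z - z.
  apply: (scalerI s0); rewrite pw sl scale0r sub0r -scaleNr.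
  by rewrite sinB sl mul0r sub0r opprK cl mul1r.
suff Mz (z : 'cV_4) : M ^+ l *m z - z = 0.
  by apply: eq_colmul => z; rewrite mul1mx; apply/subr0_eq.
have comm (y : 'cV[R]_4) : M *m (M ^+ l *m y) = M ^+ l *m (M *m y).
  by rewrite !mulmxA !mulmxE -exprS -exprSr.
(* [M^l - 1 = (M - 1) (1 + M + ... + M^(l-1))] puts [M^l z - z] in the range of [M - 1]; it is fixed
   by [M] because [M^l] is the identity on that range. *)
apply: (@fixed_range_eq0 ((\sum_(i < l) M ^+ i) *m z)).
  rewrite -[X in _ = _ - X]mul1mx -mulmxBl mulmxA mulmxE -[1%:M]/1 -subrX1.
  by rewrite mulmxBl mul1mx.
by rewrite mulmxBr comm -(subrK z (M *m z)) mulmxDr fixw opprD addrACA subrr add0r.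
Qed.

End TimelikeStabiliser.

End LorentzAlgebra.

(** * Linear equations depending on a parameter *)

Section LinearODE.
Context {R : realType} {n : nat}.
Implicit Types (Y H : 'M[R]_n) (y h : R -> 'M[R]_n).

Lemma is_derive_sum_pt (I : finType) (f : I -> R -> R) (df : I -> R) (s : R) :
  (forall i, is_derive s 1 (f i) (df i)) ->
  is_derive s 1 (fun t => \sum_i f i t) (\sum_i df i).
Proof.
move=> fdf; rewrite (_ : (fun t => _) = \sum_i f i).
  by elim/big_ind2 : _ => // [|] *; [exact: is_derive_cst|exact: is_deriveD].
by apply/funext => t; rewrite fct_sumE.
Qed.

Lemma is_derive_mxE (m p : nat) (f : R -> 'M[R]_(m, p)) df (s : R) i j :
  is_derive s 1 f df -> is_derive s 1 (fun t => f t i j) (df i j).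
Proof.
move=> [fs <-]; rewrite derive_mx// mxE; apply: derivableP.
exact: (derivable_mxP _ _ _).1.
Qed.

Definition sqnorm Y : R := \sum_i \sum_j Y i j ^+ 2.

Lemma sqnorm_ge0 Y : 0 <= sqnorm Y.
Proof. by apply: sumr_ge0 => i _; apply: sumr_ge0 => j _; apply: sqr_ge0. Qed.

Lemma sqnorm_entry Y i j : Y i j ^+ 2 <= sqnorm Y.
Proof.
rewrite /sqnorm (bigD1 i)//= (bigD1 j)//= -addrA lerDl addr_ge0//.
  by apply: sumr_ge0 => k _; apply: sqr_ge0.
by apply: sumr_ge0 => k _; apply: sumr_ge0 => l _; apply: sqr_ge0.
Qed.

Lemma sqnorm_trace Y : \tr Y ^+ 2 <= n%:R ^+ 2 * sqnorm Y.
Proof.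
have trB : `|\tr Y| <= n%:R * Num.sqrt (sqnorm Y).
  rewrite /mxtrace; apply: le_trans (ler_norm_sum _ _ _) _.
  rewrite mulr_natl -[X in _ *+ X]card_ord -sumr_const; apply: ler_sum => i _.
  by rewrite -sqrtr_sqr ler_wsqrtr// sqnorm_entry.
rewrite -[sqnorm Y]sqr_sqrtr ?sqnorm_ge0// -exprMn -real_normK ?num_real//.
by rewrite ler_sqr ?nnegrE// mulr_ge0 ?sqrtr_ge0.
Qed.

Lemma is_derive_sqnorm y dy (s : R) : is_derive s 1 y dy ->
  is_derive s 1 (fun t => sqnorm (y t)) (\sum_i \sum_j 2 * (y s i j * dy i j)).
Proof.
move=> yd; apply: is_derive_sum_pt => i; apply: is_derive_sum_pt => j.
have yij := is_derive_mxE i j yd.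
apply: is_derive_eq.
by rewrite /GRing.scale /=; ring.
Qed.

(** The inequality [2 |a b| <= a^2 + b^2] is applied to each term of the triple sum. Each square is
    independent of one of the three indices, whence the factor [n]. *)
Lemma pairing_mulmx_le (K : R) (eta Y H : 'M[R]_n) :
  (forall i j, `|eta i j| <= K) ->
  `|\sum_i \sum_j 2 * (Y i j * (eta *m H) i j)| <=
  K * n%:R * (sqnorm Y + sqnorm H).
Proof.
move=> etaK.
have B i j k : `|2 * (Y i j * (eta i k * H k j))| <= K * (Y i j ^+ 2 + H k j ^+ 2).
  have h : 2 * `|Y i j * H k j| <= Y i j ^+ 2 + H k j ^+ 2.
    rewrite normrM -[Y i j ^+ 2]real_normK ?num_real//.
    rewrite -[H k j ^+ 2]real_normK ?num_real// -subr_ge0.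
    by have := sqr_ge0 (`|Y i j| - `|H k j|); rewrite sqrrB; lra.
  have -> : 2 * (Y i j * (eta i k * H k j)) = eta i k * (2 * (Y i j * H k j)).
    by ring.
  rewrite normrM ler_pM//; apply: le_trans h.
  by rewrite normrM normr_nat.
apply: (@le_trans _ _ (\sum_i \sum_j \sum_k K * (Y i j ^+ 2 + H k j ^+ 2))).
  apply: le_trans (ler_norm_sum _ _ _) _; apply: ler_sum => i _.
  apply: le_trans (ler_norm_sum _ _ _) _; apply: ler_sum => j _.
  rewrite mxE !mulr_sumr; apply: le_trans (ler_norm_sum _ _ _) _.
  by apply: ler_sum => k _.
rewrite le_eqVlt; apply/orP; left; apply/eqP.
under eq_bigr => i _ do under eq_bigr => j _ do rewrite -mulr_sumr big_split /=.
under eq_bigr => i _ do rewrite -mulr_sumr.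
rewrite -mulr_sumr -mulrA; congr (_ * _).
under eq_bigr => i _ do rewrite big_split /=.
rewrite big_split mulrDr /=; congr (_ + _).
  rewrite /sqnorm mulr_sumr; apply: eq_bigr => i _.
  rewrite mulr_sumr; apply: eq_bigr => j _.
  by rewrite sumr_const card_ord mulr_natl.
rewrite sumr_const card_ord mulr_natl /sqnorm exchange_big//.
Qed.

(* Unlike the norm, its square is differentiable where [y] vanishes. *)
Lemma sqnorm_gronwall (K M T mu : R) (eta : R -> 'M[R]_n) y h (F dF : R -> R)
    (a := K * n%:R * (2 * M + 1)) (b := K * n%:R) :
  0 <= K -> 
  (forall s, 0 <= s <= T -> forall i j, `|eta s i j| <= K) ->
  `|mu| <= M ->
  (forall s : R, is_derive s 1 y (- (eta s *m (mu *: y s + h s)))) ->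
  (forall s : R, is_derive s 1 F (dF s)) ->
  (forall s, 0 <= s <= T -> b * sqnorm (h s) <= expR (a * s) * dF s) ->
  sqnorm (y 0) <= F 0 ->
  forall s, 0 <= s <= T -> sqnorm (y s) <= expR (a * s) * F s.
Proof.
move=> K0 etaK muM yd Fd hF y0 s /andP[s0 sT].
(* The integrating factor absorbs the terms in [sqnorm y]: in [a], the part [2 * M] comes from
   [mu *: y] and the part 1 from the coupling with [h]. What remains, [b * sqnorm h], is dominated
   by [dF], so [D] does not increase. *)
pose D (t : R) : R := expR (- a * t) * sqnorm (y t) - F t.
pose dy (t : R) : 'M[R]_n := - (eta t *m (mu *: y t + h t)).
pose dD (t : R) : R := expR (- a * t) * (\sum_i \sum_j 2 * (y t i j * dy t i j)
               - a * sqnorm (y t)) - dF t.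
have Dd (t : R) : is_derive t (1 : R) D (dD t).
  have yd' := is_derive_sqnorm (yd t).
  have ed : is_derive t (1 : R) (fun t : R => - a * t) (- a).
    by apply: is_derive_eq (is_deriveZ _ _) _; rewrite [LHS]mulr1.
  have {}ed := is_derive1_comp (is_derive_expR _) ed.
  have Dd := is_deriveB (is_deriveM ed yd') (Fd t).
  apply: is_derive_eq Dd _.
  by rewrite /dD /GRing.scale /=; ring.
have Dle t : t \in `[0, s] -> dD t <= 0.
  rewrite in_itv /= => /andP[t0 ts].
  have tT : 0 <= t <= T by rewrite t0 (le_trans ts).
  have P Y H := pairing_mulmx_le Y H (etaK _ tT).
  rewrite /dD; have -> : \sum_i \sum_j 2 * (y t i j * dy t i j) =
     - (mu * \sum_i \sum_j 2 * (y t i j * (eta t *m y t) i j)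
        + \sum_i \sum_j 2 * (y t i j * (eta t *m h t) i j)).
    rewrite mulr_sumr -big_split -sumrN; apply: eq_bigr => i _ /=.
    rewrite mulr_sumr -big_split -sumrN; apply: eq_bigr => j _ /=.
    by rewrite /dy mulmxDr -scalemxAr !mxE; ring.
  have := P (y t) (y t); have := P (y t) (h t).
  set S1 := \sum_i _; set S2 := \sum_i _ => PS1 PS2.
  have Na := sqnorm_ge0 (y t).
  have S1le : - (mu * S2) <= M * (K * n%:R * (sqnorm (y t) + sqnorm (y t))).
    apply: le_trans (ler_norm _) _; rewrite normrN normrM.
    by rewrite ler_pM.
  have S2le : - S1 <= K * n%:R * (sqnorm (y t) + sqnorm (h t)).
    by apply: le_trans (ler_norm _) _; rewrite normrN.
  rewrite subr_le0 mulNr expRN mulrC ler_pdivrMr ?expR_gt0//.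
  rewrite [leRHS]mulrC; apply: (le_trans _ (hF _ tT)); rewrite /a /b; lra.
have Dc : {within `[0, s], continuous D}.
  apply: continuous_subspaceT => t.
  by apply/differentiable_continuous/derivable1_diffP; case: (Dd t).
have [c cs] := MVT_segment s0 (fun t _ => Dd t) Dc.
rewrite subr0 => DE.
have : D s <= 0.
  have D0 : D 0 <= 0 by rewrite /D mulr0 expR0 mul1r subr_le0.
  have : dD c * s <= 0 by rewrite mulr_le0_ge0// Dle.
  by move=> h1; lra.
rewrite /D subr_le0 mulNr expRN => h1.
by rewrite mulrC -ler_pdivrMr ?expR_gt0// mulrC.
Qed.

End LinearODE.

(** * Divided differences in the spectral parameter *)

Section ParallelFamily.
Context {R : realType} {d : nat}.
Variables (K T : R) (eta : R -> 'M[R]_d) (A : R -> R -> 'M[R]_d).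
Hypotheses (K0 : 0 <= K) (T0 : 0 <= T).
Hypothesis etaK : forall s, 0 <= s <= T -> forall i j, `|eta s i j| <= K.
Hypothesis A_at0 : forall mu, A mu 0 = 1%:M.
Hypothesis A_derive : forall mu (s : R),
  is_derive s (1 : R) (A mu) (- mu *: (eta s *m A mu s)).

(* [divdiff nu k mu s] is the divided difference of [A _ s] at the nodes
   [nu 0, ..., nu (k - 1), mu]. *)
Fixpoint divdiff (nu : nat -> R) (k : nat) (mu : R) : R -> 'M[R]_d :=
  if k is l.+1 then
    fun s => (mu - nu l)^-1 *: (divdiff nu l mu s - divdiff nu l (nu l) s)
  else A mu.

Let forcing (nu : nat -> R) (k : nat) (s : R) : 'M[R]_d :=
  if k is l.+1 then divdiff nu l (nu l) s else 0.

(** This is the Leibniz rule for divided differences of [mu * A mu]: besides [mu] times the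
    difference of order [k], it produces the one of order [k - 1] on the nodes without [mu], which
    is [forcing]. *)
Lemma divdiff_ode nu k mu (s : R) : injective nu ->
  (forall i, (i < k)%N -> mu != nu i) ->
  is_derive s (1 : R) (divdiff nu k mu)
    (- (eta s *m (mu *: divdiff nu k mu s + forcing nu k s))).
Proof.
move=> nuI; elim: k mu => [|k IH] mu muk.
  by rewrite /= addr0 -scalemxAr -scaleNr; exact: A_derive.
have D1 := IH mu (fun i ik => muk i (ltnW ik)).
have D2 : is_derive s (1 : R) (divdiff nu k (nu k))
    (- (eta s *m (nu k *: divdiff nu k (nu k) s + forcing nu k s))).
  by apply: IH => i ik; rewrite (inj_eq nuI) gtn_eqF.
have D := is_deriveZ (mu - nu k)^-1 (is_deriveB D1 D2).
apply: is_derive_eq D _ => /=.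
have m0 : mu - nu k != 0 by rewrite subr_eq0 muk.
move: (divdiff nu k mu s) (divdiff nu k (nu k) s) (forcing nu k s) => P Q H.
rewrite opprK [- (_ *m _) + _]addrC -mulmxBr scalemxAr -mulmxN; congr (_ *m _).
by apply/matrixP => i j; rewrite !mxE; field.
Qed.

(** The initial value does not depend on [mu], so its differences of positive order vanish. *)
Lemma divdiff_at0 nu k mu : divdiff nu k.+1 mu 0 = 0.
Proof.
elim: k mu => [|k IH] mu /=; first by rewrite !A_at0 subrr scaler0.
by have /= -> := IH mu; have /= -> := IH (nu k.+1); rewrite subrr scaler0.
Qed.

(** Each order is driven by the previous one and starts at 0, so Gronwall integrates the bound once
    per order. These iterated integrals of [s^k] supply the factorial. *)
Lemma divdiff_bound (M : R) nu k mu
    (a := K * d%:R * (2 * M + 1)) (b := K * d%:R) :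
  injective nu -> (forall i, (i < k)%N -> mu != nu i) ->
  `|mu| <= M -> (forall i, (i < k)%N -> `|nu i| <= M) ->
  forall s, 0 <= s <= T ->
    sqnorm (divdiff nu k mu s) <= expR (a * s) * (d%:R * b ^+ k / k`!%:R * s ^+ k).
Proof.
move=> nuI; elim: k mu => [|k IH] mu muk muM nuM.
  move=> s sT; rewrite !expr0 fact0 invr1 !mulr1; move: s sT.
  apply: (@sqnorm_gronwall _ _ K M T mu eta _ (forcing nu 0) (fun=> d%:R)
            (fun=> 0)) => //.
  - by move=> s; exact: divdiff_ode.
  - move=> s _; rewrite mulr0 /= /sqnorm big1 ?mulr0// => i _.
    by rewrite big1// => j _; rewrite mxE expr0n.
  - rewrite /= A_at0 /sqnorm -[X in _ <= X%:R]card_ord -sumr_const.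
    apply: ler_sum => i _; rewrite (bigD1 i)//= big1 ?addr0 ?mxE ?eqxx ?expr1n//.
    by move=> j /negbTE ji; rewrite mxE eq_sym ji expr0n.
have b0 : 0 <= b by rewrite mulr_ge0.
(* [F] is the primitive of [dF] vanishing at 0, and [dF] is [b] times the bound of order [k]
   stripped of its exponential. *)
pose F (s : R) : R := d%:R * b ^+ k.+1 / k.+1`!%:R * s ^+ k.+1.
pose dF (s : R) : R := b * (d%:R * b ^+ k / k`!%:R * s ^+ k).
apply: (sqnorm_gronwall K0 etaK muM (h := forcing nu k.+1) (F := F) (dF := dF)).
- by move=> s; exact: divdiff_ode.
- move=> s.
  have D := is_deriveZ (d%:R * b ^+ k.+1 / k.+1`!%:R)
     (is_deriveX k.+1 (is_derive_id s (1 : R))).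
  have -> : F = (d%:R * b ^+ k.+1 / k.+1`!%:R) \*: (id ^+ k.+1).
    by apply/funext => t; rewrite /= exprfctE.
  apply: is_derive_eq D _.
  have kf : k`!%:R != 0 :> R by rewrite pnatr_eq0 -lt0n fact_gt0.
  have k1 : k.+1%:R != 0 :> R by rewrite pnatr_eq0.
  rewrite /dF /GRing.scale /= mulr1 factS natrM exprS.
  by move: k`!%:R k.+1%:R kf k1 => x y kf k1; field; rewrite kf.
- move=> s sT; rewrite /dF mulrCA ler_wpM2l//; apply: IH => //.
  + by move=> i ik; rewrite (inj_eq nuI) gtn_eqF.
  + exact: nuM.
  + by move=> i ik; apply: nuM; apply: ltnW.
- rewrite divdiff_at0 /F expr0n mulr0 /sqnorm big1// => i _.
  by rewrite big1// => j _; rewrite mxE expr0n.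
Qed.

(** The trace equals [c] at every node, so its Newton interpolant is the constant [c], and the
    divided difference is the interpolation error over the node product. *)
Lemma divdiff_trace nu c k mu : injective nu ->
  (forall i, \tr (A (nu i) T) = c) -> (forall i, (i < k.+1)%N -> mu != nu i) ->
  \tr (divdiff nu k.+1 mu T) = (\tr (A mu T) - c) / \prod_(i < k.+1) (mu - nu i).
Proof.
move=> nuI Ac; elim: k mu => [|k IH] mu muk.
  by rewrite /= linearZ linearB /= Ac big_ord1 mulrC.
rewrite [LHS]linearZ linearB /=.
have /= -> := IH mu (fun i ik => muk i (ltnW ik)).
have /= -> : \tr (divdiff nu k.+1 (nu k.+1) T) = 0.
  by rewrite IH ?Ac ?subrr ?mul0r// => i ik; rewrite (inj_eq nuI) gtn_eqF.
by rewrite subr0 [in RHS]big_ord_recr /= invfM mulrCA; congr (_ * _); rewrite mulrC.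
Qed.

Lemma trace_lipschitz (M : R) : exists2 C, 0 <= C &
  forall mu nu, `|mu| <= M -> `|nu| <= M ->
    `|\tr (A mu T) - \tr (A nu T)| <= C * `|mu - nu|.
Proof.
pose B : R := expR (K * d%:R * (2 * M + 1) * T) * (d%:R * (K * d%:R) * T).
exists (Num.sqrt (d%:R ^+ 2 * B)); first exact: sqrtr_ge0.
move=> mu nu muM nuM.
have [->|mn] := eqVneq mu nu; first by rewrite !subrr normr0 mulr0.
(* [divdiff] takes a whole sequence of nodes; any injective one starting at [nu] makes the
   difference of order 1 the difference quotient between [mu] and [nu]. *)
pose v (i : nat) := nu + i%:R.
have vI : injective v by move=> i j /addrI/eqP; rewrite eqr_nat => /eqP.
have v0 : v 0%N = nu by rewrite /v addr0.
have H : sqnorm (divdiff v 1 mu T) <= B.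
  have TT : 0 <= T <= T by rewrite T0 lexx.
  have := @divdiff_bound M v 1 mu vI _ muM _ T TT.
  rewrite !expr1 (_ : 1`! = 1%N)// invr1 mulr1; apply.
    by case=> //; rewrite v0.
  by case=> //; rewrite v0.
have -> : \tr (A mu T) - \tr (A nu T) = (mu - nu) * \tr (divdiff v 1 mu T).
  rewrite /= linearZ linearB /= v0 mulrA divff ?mul1r//.
  by rewrite subr_eq0.
rewrite normrM mulrC ler_wpM2r// -sqrtr_sqr ler_wsqrtr//.
by apply: le_trans (sqnorm_trace _) _; rewrite ler_wpM2l ?sqr_ge0.
Qed.

Lemma trace_continuous : continuous (fun mu => \tr (A mu T)).
Proof.
move=> mu; have [C C0 lip] := trace_lipschitz (`|mu| + 1).
apply/cvgrPdist_lt => e e0; near=> nu.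
have nu1 : `|mu - nu| < 1.
  by near: nu; apply: cvgr_dist_lt.
apply: le_lt_trans (lip _ _ _ _) _; first by rewrite lerDl.
  rewrite -[nu](subrK mu) addrC; apply: le_trans (ler_normD _ _) _.
  by rewrite lerD2l distrC ltW.
rewrite (@le_lt_trans _ _ ((C + 1) * `|mu - nu|))//.
  by rewrite ler_wpM2r// lerDl.
rewrite mulrC -ltr_pdivlMr ?ltr_pwDr//.
near: nu; apply: cvgr_dist_lt => //; by rewrite divr_gt0// ltr_pwDr.
Unshelve. all: by end_near. Qed.

(** An identity theorem: the error at [mu] of interpolating at ever more nodes in the interval tends
    to 0. *)
Lemma trace_constant_extends (lo hi c mu : R) : lo < hi ->
  (forall nu, lo < nu < hi -> \tr (A nu T) = c) -> \tr (A mu T) = c.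
Proof.
move=> lohi Ac.
have [/Ac//|muN] := boolP (lo < mu < hi).
(* The shift by 2 keeps the first node strictly below [hi]. *)
pose v (i : nat) := lo + (hi - lo) / (i.+2)%:R.
have vI : injective v.
  move=> i j /addrI/mulfI; rewrite subr_eq0 gt_eqF// => /(_ isT)/invr_inj/eqP.
  by rewrite eqr_nat !eqSS => /eqP.
have vin i : lo < v i < hi.
  rewrite ltrDl divr_gt0 ?subr_gt0//= -ltrBrDl ltr_pdivrMr//.
  by rewrite ltr_pMr ?subr_gt0// ltr1n.
pose M := `|mu| + `|lo| + `|hi|.
have vM i : `|v i| <= M.
  have /andP[h1 h2] := vin i.
  rewrite ler_norml /M; have := normr_ge0 mu.
  have := ler_norm lo; have := ler_norm hi.
  have := ler_norm (- lo); have := ler_norm (- hi); rewrite !normrN.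
  by move=> *; apply/andP; split; lra.
have muM : `|mu| <= M by rewrite /M -addrA lerDl addr_ge0.
have muv i : mu != v i by apply: contraNneq muN => ->.
(* [x] gathers what each node contributes to the squared error: [(2 * M) ^+ 2] from the factor
   [mu - v i], the rest from [divdiff_bound]. [E] gathers what is independent of [k]. *)
pose x : R := (2 * M) ^+ 2 * (K * d%:R) * T.
pose E : R := d%:R ^+ 2 * (expR (K * d%:R * (2 * M + 1) * T) * d%:R).
have bound k : (\tr (A mu T) - c) ^+ 2 <= E * exp_coeff x k.+1.
  have tk := @divdiff_trace v c k mu vI (fun i => Ac _ (vin i)) (fun i _ => muv i).
  have p0 : \prod_(i < k.+1) (mu - v i) != 0.
    by apply/prodf_neq0 => i _; rewrite subr_eq0.
  have -> : \tr (A mu T) - c =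
      \tr (divdiff v k.+1 mu T) * \prod_(i < k.+1) (mu - v i).
    by rewrite tk divfK.
  have pb : (\prod_(i < k.+1) (mu - v i)) ^+ 2 <= ((2 * M) ^+ 2) ^+ k.+1.
    rewrite exprAC -real_normK ?num_real// lerXn2r ?nnegrE ?exprn_ge0//.
      by rewrite mulr_ge0// (le_trans _ muM).
    rewrite normr_prod -[X in _ ^+ X]card_ord -prodr_const ler_prod// => i _.
    rewrite normr_ge0 (le_trans (ler_normB _ _))//.
    by have := vM i; lra.
  rewrite exprMn mulrC.
  have TT : 0 <= T <= T by rewrite T0 lexx.
  have := sqnorm_trace (divdiff v k.+1 mu T).
  have := @divdiff_bound M v k.+1 mu vI (fun i _ => muv i) muM (fun i _ => vM i) T TT.
  move=> b1 b2.
  apply: le_trans (ler_pM _ _ pb (le_trans b2 (ler_wpM2l _ b1))) _.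
  - exact: sqr_ge0.
  - exact: sqr_ge0.
  - exact: sqr_ge0.
  rewrite le_eqVlt; apply/orP; left; apply/eqP.
  rewrite /E /x /exp_coeff /= !exprMn.
  by move: (k.+1`!%:R^-1) => y; ring.
apply/eqP; rewrite -subr_eq0 -sqrf_eq0 eq_le sqr_ge0 andbT.
(* The terms of the exponential series tend to 0. *)
have cv : E * exp_coeff x k.+1 @[k --> \oo] --> 0.
  rewrite -(mulr0 E); apply: cvgMl_tmp.
  by rewrite (cvg_shiftS (exp_coeff x) (nbhs 0)); exact: cvg_exp_coeff.
by apply: (cvgr_to_ge cv); apply: nearW => k; exact: bound.
Qed.

End ParallelFamily.

(** * Smooth curves and rational angles *)

Section Calculus.
Context {R : realType}.

Lemma smooth_derive (V : normedModType R) (f : R -> V) (s : R) :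
  smooth f -> is_derive s (1 : R) f (derive1 f s).
Proof. by move=> fs; rewrite derive1E; exact: derivableP (fs 0%N s). Qed.

Lemma smooth_derive1 (V : normedModType R) (f : R -> V) :
  smooth f -> smooth (derive1 f).
Proof. by move=> fs n s; have := fs n.+1 s; rewrite derive1Sn. Qed.

Lemma is_derive_mx (m n : nat) (f : R -> 'M[R]_(m, n)) (df : 'M[R]_(m, n)) (s : R) :
  (forall i j, is_derive s (1 : R) (fun t => f t i j) (df i j)) ->
  is_derive s (1 : R) f df.
Proof.
move=> fd; have fs : derivable f s 1.
  by apply: (derivable_mxP f s 1).2 => i j; case: (fd i j).
apply: DeriveDef => //; rewrite derive_mx//; apply/matrixP => i j; rewrite mxE.
by case: (fd i j).
Qed.

Lemma is_derive_unique (f : R -> R) (s a b : R) :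
  is_derive s (1 : R) f a -> is_derive s (1 : R) f b -> a = b.
Proof. by move=> [_ <-] [_ <-]. Qed.

Lemma is_derive_mulmx_vec (m n : nat) (B : R -> 'M[R]_(m, n))
    (dB : 'M[R]_(m, n)) (w : 'cV[R]_n) (s : R) :
  is_derive s (1 : R) B dB ->
  is_derive s (1 : R) (fun t => B t *m w : 'cV[R]_m) (dB *m w).
Proof.
move=> Bd; apply: is_derive_mx => i j.
have -> : (fun t => (B t *m w) i j) = (fun t => \sum_k B t i k * w k j).
  by apply/funext => t; rewrite mxE.
rewrite mxE; apply: is_derive_sum_pt => k.
have D := is_deriveM (is_derive_mxE i k Bd) (is_derive_cst (w k j : R) s (1 : R)).
by apply: is_derive_eq D _; rewrite scaler0 add0r [LHS]mulrC.
Qed.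

Lemma is_derive_lform (u v : R -> 'cV[R]_4) (du dv : 'cV[R]_4) (s : R) :
  is_derive s (1 : R) u du -> is_derive s (1 : R) v dv ->
  is_derive s (1 : R) (fun t => lform (u t) (v t))
    (lform du (v s) + lform (u s) dv).
Proof.
move=> ud vd; under eq_fun do rewrite lform_sum.
rewrite !lform_sum -big_split; apply: is_derive_sum_pt => i /=.
have D := is_deriveZ (if i == ord0 then -1 else 1 : R)
  (is_deriveM (is_derive_mxE i 0 ud) (is_derive_mxE i 0 vd)).
apply: is_derive_eq D _; rewrite /GRing.scale /=.
by case: ifP => _; ring.
Qed.

Lemma wedge_bounded (u v : R -> 'cV[R]_4) (T : R) :
  (forall i s, {for s, continuous (fun t => u t i 0)}) ->
  (forall i s, {for s, continuous (fun t => v t i 0)}) ->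
  exists2 K : R, 0 <= K &
    forall s, 0 <= s <= T -> forall i j, `|wedge (u s) (v s) i j| <= K.
Proof.
move=> uc vc; have [T0|/lt_geF T0] := leP 0 T; last first.
  by exists 0 => // s /andP[s0 sT]; have := le_trans s0 sT; rewrite T0.
(* The sum dominates every entry at once, so a single maximum over the compact interval suffices. *)
pose S t := \sum_i \sum_j `|wedge (u t) (v t) i j|.
have wc i j : continuous (fun t => wedge (u t) (v t) i j).
  under eq_fun do rewrite wedgeE.
  move=> s; apply: cvgMl_tmp; apply: cvgB; apply: cvgM; (exact: uc || exact: vc).
have Sc : continuous S.
  apply: continuous_big => [|i _]; first exact: add_continuous.
  apply: continuous_big => [|j _ s]; first exact: add_continuous.
  by apply: cvg_norm; exact: wc.
have [c _ Smax] := EVT_max T0 (continuous_subspaceT Sc).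
exists (S c); first by rewrite /S; do 2![apply: sumr_ge0 => ? _].
move=> s sT i j; apply: le_trans (Smax s _); last by rewrite in_itv.
rewrite /S (bigD1 i)//= (bigD1 j)//= -addrA lerDl addr_ge0//.
  exact: sumr_ge0.
by apply: sumr_ge0 => k _; exact: sumr_ge0.
Qed.

Lemma smooth_coord_continuous (m : nat) (f : R -> 'cV[R]_m) i s :
  smooth f -> {for s, continuous (fun t => f t i 0)}.
Proof.
move=> fs; apply/differentiable_continuous/derivable1_diffP.
by case: (is_derive_mxE i 0 (smooth_derive s fs)).
Qed.

(** Density of the rational multiples of [2 pi] between [acos c2] and [acos c1], in this order
    because cosine decreases on [[0, pi]]. *)
Lemma rational_angle (c1 c2 : R) : -1 <= c1 -> c1 < c2 -> c2 <= 1 ->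
  exists (l : nat) (theta : R), [/\ (0 < l)%N, cos (l%:R * theta) = 1,
    sin theta != 0 & c1 < cos theta < c2].
Proof.
move=> c1N c12 c21.
have c1b : -1 <= c1 <= 1 by rewrite c1N (le_trans (ltW c12)).
have c2b : -1 <= c2 <= 1 by rewrite c21 (le_trans c1N (ltW c12)).
pose P : R := pi *+ 2.
have P0 : 0 < P by rewrite pmulrn_lgt0// pi_gt0.
have t1K : cos (acos c1) = c1 by apply: acosK; rewrite in_itv.
have t2K : cos (acos c2) = c2 by apply: acosK; rewrite in_itv.
have in1 : acos c1 \in `[0, pi] by rewrite in_itv /= acos_ge0 ?acos_lepi.
have in2 : acos c2 \in `[0, pi] by rewrite in_itv /= acos_ge0 ?acos_lepi.
have t12 : acos c2 < acos c1 by rewrite -(ltr_cos in2 in1) t1K t2K.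
pose x := acos c2 / P; pose y := acos c1 / P.
have xy : 0 < y - x by rewrite subr_gt0 ltr_pM2r ?invr_gt0.
have x0 : 0 <= x by rewrite divr_ge0 ?acos_ge0// ltW.
(* [l] is large enough for the interval from [x l] to [y l] to be longer than 1; [j] is the first
   integer strictly above [x l]. *)
pose l := (Num.truncn (y - x)^-1).+1; pose j := (Num.truncn (x * l%:R)).+1.
have l0 : 0 < l%:R :> R by rewrite ltr0n.
have l1 : 1 < (y - x) * l%:R.
  by rewrite mulrC -ltr_pdivrMr// mul1r truncnS_gt.
have j1 : x * l%:R < j%:R by rewrite truncnS_gt.
have j2 : j%:R < y * l%:R.
  have : j%:R <= x * l%:R + 1.
    by rewrite /j -natr1 lerD2r truncn_le mulr_ge0// ltW.
  by move: l1; rewrite mulrBl; lra.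
pose theta := j%:R / l%:R * P.
have th1 : acos c2 < theta by rewrite -ltr_pdivrMr// ltr_pdivlMr.
have th2 : theta < acos c1 by rewrite -ltr_pdivlMr// ltr_pdivrMr.
have inth : theta \in `[0, pi].
  rewrite in_itv /= (le_trans _ (ltW th1)) ?acos_ge0//=.
  by rewrite (le_trans (ltW th2)) ?acos_lepi.
have cth : c1 < cos theta < c2.
  by rewrite -{1}t1K -[X in _ && (_ < X)]t2K !ltr_cos// th1 th2.
exists l, theta; split => //.
  have -> : l%:R * theta = 0 + P *+ j.
    by rewrite add0r -[RHS]mulr_natl /theta mulrA mulrCA divff ?mulr1 ?gt_eqF.
  by rewrite periodicn ?cos0//; exact: cosD2pi.
rewrite -norm_cos_eq1; case/andP: cth => h1 h2.
by rewrite lt_eqF// ltr_norml (le_lt_trans c1N h1) (lt_le_trans h2 c21).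
Qed.

End Calculus.

(** * The monodromy of an arc-length polarised curve *)

Section ArclengthPolarisation.
Context {R : realType}.
Variables (kappa T : R) (L : R -> {vspace 'cV[R]_4}) (m : R -> R).
Variables (X : R -> 'cV[R]_4) (A : R -> R -> 'M[R]_4).
Variables (fq : 'cV[R]_4) (x : R -> 'cV[R]_4).
Hypothesis null : forall s, null_line (L s).
Hypothesis m0 : forall s, m s != 0.
Hypothesis LT : closed_curve L m T.
Hypothesis fq_norm : lform fq fq = - kappa.
Hypothesis xL : line_section L x.
Hypothesis x_fq : forall s, lform (x s) fq = -1.
Hypothesis x_speed : forall s, (m s)^-1 = lform (derive1 x s) (derive1 x s).
Hypothesis XL : nonvanishing_section L X.
Hypothesis A_parallel : forall mu : R, parallel_frame (connection_form m X) mu (A mu).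

Let x' := derive1 x.

Let x_derive s : is_derive s (1 : R) x (x' s).
Proof. by apply: smooth_derive; case: xL. Qed.

Lemma section_norm s : lform (x s) (x s) = 0.
Proof. by apply: (null s).2; case: xL. Qed.

Lemma section_velocity s : lform (x s) (x' s) = 0.
Proof.
have D := is_derive_lform (x_derive s) (x_derive s).
have D0 : is_derive s (1 : R) (fun t => lform (x t) (x t)) 0.
  under eq_fun do rewrite section_norm; exact: is_derive_cst.
have := is_derive_unique D D0; rewrite [lform (x' s) _]lformC; lra.
Qed.

Lemma velocity_fq s : lform (x' s) fq = 0.
Proof.
have D := is_derive_lform (x_derive s) (is_derive_cst fq s (1 : R)).
have D0 : is_derive s (1 : R) (fun t => lform (x t) fq) 0.
  under eq_fun do rewrite x_fq; exact: is_derive_cst.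
have := is_derive_unique D D0.
by rewrite lform0r addr0.
Qed.

Lemma section_line s v : v \in L s -> v = - lform v fq *: x s.
Proof.
move=> vL; have x0 : x s != 0.
  apply: contraPneq (x_fq s) => ->; rewrite lformC lform0r.
  by move/eqP; rewrite eq_sym oppr_eq0 oner_eq0.
have LE : L s = <[x s]>%VS.
  apply/esym/eqP; rewrite eqEdim dim_vline x0 (null s).1 leqnn andbT.
  by rewrite -memvE; case: xL.
move: vL; rewrite LE => /vlineP[k ->].
by rewrite lformZl x_fq mulrN1 opprK.
Qed.

(** The normalisation [(x, fq) = -1] selects one vector in each line, so the periodicity of [L]
    passes to [x]. *)
Lemma section_periodic : x T = x 0.
Proof.
have [_ /(_ 0)[LE _]] := LT; rewrite add0r in LE.
have := xL.2 T; rewrite LE => /section_line ->.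
by rewrite x_fq opprK scale1r.
Qed.

(** Write [X = a x]. As [x] is null and orthogonal to [x'], the term [a' x] contributes neither to
    [X /\ X'] nor to [(X', X')]; both scale by [a^2], and [(x', x') = 1 / m] cancels the remaining
    factor. *)
Lemma connection_formE s : connection_form m X s = wedge (x s) (x' s).
Proof.
have [[Xsm XLs] X0] := XL.
(* Pairing with the constant [fq] exhibits the coefficient [a] as differentiable. *)
pose a t := - lform (X t) fq.
have XE t : X t = a t *: x t by exact: section_line.
have a0 : a s != 0 by apply: contraNneq (X0 s) => a0; rewrite XE a0 scale0r.
have X_derive := smooth_derive s Xsm.
pose a' := - lform (derive1 X s) fq.
have a_derive : is_derive s (1 : R) a a'.
  have D := is_deriveN (is_derive_lform X_derive (is_derive_cst fq s (1 : R))).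
  apply: is_derive_eq D _.
  by rewrite lform0r addr0.
have X'E : derive1 X s = a' *: x s + a s *: x' s.
  apply/matrixP => i j.
  apply: (is_derive_unique (is_derive_mxE i j X_derive)).
  have -> : (fun t => X t i j) = (fun t => a t * x t i j).
    by apply/funext => t; rewrite XE mxE.
  have D := is_deriveM a_derive (is_derive_mxE i j (x_derive s)).
  by apply: is_derive_eq D _; rewrite !mxE addrC /GRing.scale /= [_ * a']mulrC.
rewrite /connection_form X'E [in wedge _ _]XE wedge_lift scalerA.
rewrite !(lformDl, lformDr, lformZl, lformZr) section_norm section_velocity.
rewrite [lform (x' s) (x s)]lformC section_velocity -x_speed.
rewrite !(mulr0, add0r, addr0) -[RHS]scale1r; congr (_ *: _).
by field; rewrite a0 m0.
Qed.

Let p mu s := fq + mu *: x s.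

Lemma axis_timelike mu : - kappa / 2 < mu -> lform (p mu 0) (p mu 0) < 0.
Proof.
move=> hmu; rewrite /p !(lformDl, lformDr, lformZl, lformZr) section_norm.
by rewrite fq_norm [lform fq (x 0)]lformC x_fq; lra.
Qed.

Lemma A_derive mu (s : R) :
  is_derive s (1 : R) (A mu) (- mu *: (wedge (x s) (x' s) *m A mu s)).
Proof. by have [_ _ /(_ s)] := A_parallel mu; rewrite connection_formE. Qed.

Lemma monodromy_axis mu : A mu T *m p mu 0 = p mu 0.
Proof.
have [SO A0 _] := A_parallel mu.
have p_derive s : is_derive s (1 : R) (p mu) (mu *: x' s).
  have D := is_deriveD (is_derive_cst fq s (1 : R)) (is_deriveZ mu (x_derive s)).
  by apply: is_derive_eq D _; rewrite add0r.
(* The derivative of this pairing cancels because [(x, p) = -1] and [(x', p) = 0]. *)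
have cst w : lform (A mu T *m w) (p mu T) = lform (A mu 0 *m w) (p mu 0).
  apply: (is_derive_0_is_cst (f := fun t => lform (A mu t *m w) (p mu t))) => s.
  have D := is_derive_lform (is_derive_mulmx_vec w (A_derive mu s)) (p_derive s).
  apply: is_derive_eq D _.
  rewrite -scalemxAl -mulmxA wedge_mulE lformZl lformBl !lformZl lformZr.
  rewrite /p !(lformDr, lformZr) x_fq section_norm velocity_fq.
  rewrite [lform (x' s) (x s)]lformC section_velocity [lform (A mu s *m w) _]lformC.
  ring.
have pT : p mu T = p mu 0 by rewrite /p section_periodic.
have detA := (SO T).2.
have Aunit : A mu T \in unitmx by rewrite unitmxE detA unitr1.
apply/esym/eqP; rewrite -subr_eq0; apply/eqP; apply: lform_nondegenerate => u.
(* Every [u] is [A mu T *m w] for some [w]. Its product with [A mu T *m p] is [(w, p)] by isometry,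
   and its product with [p] is [(w, p)] by [cst] and periodicity. *)
rewrite -(mulKVmx Aunit u) lformBr lform_isometry; last by case: (SO T).
by rewrite -{1}pT cst A0 mul1mx subrr.
Qed.

Lemma monodromy_at0 : A 0 T = 1%:M.
Proof.
have [_ <- _] := A_parallel 0; apply/matrixP => i j.
apply: (is_derive_0_is_cst (f := fun t => A 0 t i j)) => s.
have D := is_derive_mxE i j (A_derive 0 s).
by apply: is_derive_eq D _; rewrite oppr0 scale0r mxE.
Qed.

Let f mu := \tr (A mu T).

Let eta_bounded : exists2 K : R, 0 <= K & forall s, 0 <= s <= T ->
  forall i j, `|wedge (x s) (x' s) i j| <= K.
Proof.
have [xs _] := xL.
have x's : smooth x' by exact: smooth_derive1 xs.
by apply: wedge_bounded => i s;
  [exact: smooth_coord_continuous xs|exact: smooth_coord_continuous x's].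
Qed.

Let T0 : 0 <= T. Proof. by case: LT => /ltW. Qed.
Let A_at0 mu : A mu 0 = 1%:M. Proof. by case: (A_parallel mu). Qed.

Lemma monodromy_trace_continuous : continuous f.
Proof.
have [K K0 etaK] := eta_bounded.
exact: (trace_continuous K0 T0 etaK A_at0 A_derive).
Qed.

Lemma monodromy_trace_extends (lo hi c mu : R) : lo < hi ->
  (forall nu, lo < nu < hi -> f nu = c) -> f mu = c.
Proof.
have [K K0 etaK] := eta_bounded.
exact: (trace_constant_extends K0 T0 etaK A_at0 A_derive).
Qed.

Lemma monodromy_trace0 : f 0 = 4.
Proof. by rewrite /f monodromy_at0 mxtrace1. Qed.

Lemma resonance_exists :
  exists mu, resonance_on_multiple_cover (fun nu => A nu T) mu /\ - kappa / 2 < mu.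
Proof.
have SO mu : SO31 (A mu T) by case: (A_parallel mu).
(* A reference parameter above [- kappa / 2] that is also positive, hence nonzero. *)
pose nu := Num.max 0 (- kappa / 2) + 1.
have nu0 : 0 < nu by rewrite /nu ltr_pwDr// le_max lexx.
have nuk : - kappa / 2 < nu by rewrite /nu ltr_pwDr// le_max lexx orbT.
have [cst|] := pselect (forall mu, - kappa / 2 < mu -> f mu = f nu).
  exists nu; split => //; split; first by rewrite gt_eqF.
  exists 1%N; split => //; rewrite expr1.
  apply: (trace4_eq1 (SO nu) (axis_timelike nuk) (monodromy_axis nu)).
  rewrite -monodromy_trace0; apply/esym.
  apply: (@monodromy_trace_extends (- kappa / 2) (- kappa / 2 + 1)).
    by rewrite ltrDl.
  by move=> mu /andP[h _]; exact: cst.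
move=> /existsNP[mu1 /not_implyP[mu1k /eqP fne]].
have range mu (h : - kappa / 2 < mu) : -2 <= f mu - 2 <= 2.
  exact: (trace_timelike_stabiliser (SO mu) (axis_timelike h) (monodromy_axis mu)).
pose lo := Num.min (f nu) (f mu1); pose hi := Num.max (f nu) (f mu1).
have lohi : lo < hi.
  move: fne; rewrite eq_sym neq_lt /lo /hi => /orP[]fl.
    by rewrite min_l ?max_r ?ltW.
  by rewrite min_r ?max_l ?ltW.
have lo2 : 0 <= lo.
  by rewrite /lo le_min; have := range _ nuk; have := range _ mu1k; lra.
have hi2 : hi <= 4.
  by rewrite /hi ge_max; have := range _ nuk; have := range _ mu1k; lra.
(* The bounds translate [lo < 2 + 2 cos theta < hi] into a range for [cos theta]. *)
have [|||l [theta [l0 cl s0 /andP[th1 th2]]]] :=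
    @rational_angle R ((lo - 2) / 2) ((hi - 2) / 2); try lra.
have IVT2 a b : a <= b -> Num.min (f a) (f b) = lo -> Num.max (f a) (f b) = hi ->
    exists2 mu, mu \in `[a, b] & f mu = 2 + 2 * cos theta.
  move=> ab mn mx; apply: IVT => //.
    exact/continuous_subspaceT/monodromy_trace_continuous.
  by rewrite mn mx; lra.
have [mu muk fmu] : exists2 mu, - kappa / 2 < mu & f mu = 2 + 2 * cos theta.
  have [le12|le21] := leP nu mu1.
    have [mu] := IVT2 _ _ le12 erefl erefl; rewrite in_itv /= => /andP[h _] E.
    by exists mu => //; exact: lt_le_trans h.
  have [||mu] := IVT2 _ _ (ltW le21); [by rewrite minC|by rewrite maxC|].
  rewrite in_itv /= => /andP[h _] E.
  by exists mu => //; exact: lt_le_trans h.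
exists mu; split => //; split.
  (* [f mu < hi <= 4], whereas [f 0 = 4]. *)
  by apply/eqP => mu0; move: fmu; rewrite mu0 monodromy_trace0; lra.
exists l; split => //.
apply: (rational_rotation_expr (SO mu) (axis_timelike muk) (monodromy_axis mu) s0) => //.
by rewrite -/(f mu) fmu addrC addKr.
Qed.

End ArclengthPolarisation.

Theorem theorem4p6 (R : realType) (kappa T : R)
    (L : R -> {vspace 'cV[R]_4}) (m : R -> R)
    (X : R -> 'cV[R]_4) (A : R -> R -> 'M[R]_4) :
  polarised_curve L m ->
  closed_curve L m T ->
  arclength_polarisation kappa L m ->
  nonvanishing_section L X ->
  (forall mu : R, parallel_frame (connection_form m X) mu (A mu)) ->
  finite_type (fun mu => A mu T) ->
  exists mu : R,
    resonance_on_multiple_cover (fun nu => A nu T) mu /\ - kappa / 2 < mu.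
Proof.
move=> [[null _] [_ m0]] LT [fq [x [fqE xL x_fq x_speed]]] XL A_parallel _.
exact: (resonance_exists null m0 LT fqE xL x_fq x_speed XL A_parallel).
Qed.
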